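(* Let $R$ be a ring and let $G$ be a group of type $\mathrm{FP}(R)$ with $\mathrm{cd}_R(G) = n$. Suppose that $\chi \colon G \to \mathbb{R}$ is a nontrivial character such that $$H^n(G; \widehat{R[G]}^{\chi}) = 0 \quad\text{and}\quad H^n(G; \widehat{R[G]}^{-\chi}) = 0.$$ Then $\mathrm{cd}_R(\ker \chi) < n$.
   Context: Rings are unital, associative, and nonzero (not necessarily commutative). $\mathbb{R}$ denotes the additive group of real numbers, and a character is a group homomorphism $G \to \mathbb{R}$. For a nontrivial homomorphism $\chi \colon G \to \mathbb{R}$, the Novikov ring $\widehat{R[G]}^{\chi}$ is the set of formal series $\sum_{g \in G} \lambda_g g$ with $\lambda_g \in R$ such that $|\{g \in G : \lambda_g \neq 0 \text{ and } \chi(g) \leqslant r\}| < \infty$ for all $r \in \mathbb{R}$, with the obvious addition and multiplication extending those of the group ring $R[G]$. It contains $R[G]$ and is viewed as a left $R[G]$-module by left multiplication. For an $R[G]$-module $M$, $H^n(G;M) = \mathrm{Ext}^n_{R[G]}(R,M)$, where $R$ is the trivial $R[G]$-module. $G$ is of type $\mathrm{FP}(R)$ if the trivial $R[G]$-module $R$ admits a finite-length resolution by finitely generated projective $R[G]$-modules. $\mathrm{cd}_R(G)$ is the minimal length of a projective resolution of the trivial $R[G]$-module $R$ (and $\infty$ if none of finite length exists). *)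

(* Defs.v *)
From HB Require Import structures.
From mathcomp Require Import all_boot all_order all_algebra finmap.
From mathcomp Require Import monoid ring_quotient.
From mathcomp Require Import all_classical reals ereal.

Set Implicit Arguments.
Unset Strict Implicit.
Unset Printing Implicit Defensive.

Import Order.TTheory GRing.Theory Num.Theory.
Local Open Scope classical_set_scope.
Local Open Scope ring_scope.

(* The group ring [R[G]] and its Novikov completions are the sets of functions
   [G -> R] whose support is small in a given sense, with the convolution
   product.  The fields are what makes convolution an inner, associative law. *)
Record supports (G : groupType) := Supports {
  small :> set G -> Prop;
  small_sub : forall A B, A `<=` B -> small B -> small A;
  small_setU : forall A B, small A -> small B -> small (A `|` B);
  small_finite : forall A, finite_set A -> small A;
  small_mul : forall A B, small A -> small B ->
    small [set x | exists2 a, A a & exists2 b, B b & x = (a * b)%g];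
  small_fiber : forall A B x, small A -> small B ->
    finite_set [set h | A h /\ B (h^-1 * x)%g]
}.

Definition supp (T : Type) (V : zmodType) (f : T -> V) : set T :=
  [set x | f x != 0].

(* The sum is over the finitely many [h] with a nonzero summand. *)
Definition conv (R : nzRingType) (G : groupType) (f g : G -> R) : G -> R :=
  fun x => \sum_(h \in [set: G]) f h * g (h^-1 * x)%g.

Section FsumFacts.
Variables (V : zmodType) (I : choiceType).
Implicit Types (F E : I -> V) (D : set I).

Lemma fsumT_widen F D : supp F `<=` D ->
  \sum_(i \in [set: I]) F i = \sum_(i \in D) F i.
Proof.
move=> FD; apply/esym/fsbig_widen => // i [_ nDi] /=.
by apply/eqP; apply: contra_notT nDi => /FD.
Qed.

Lemma fsumTD F E : finite_set (supp F) -> finite_set (supp E) ->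
  \sum_(i \in [set: I]) (F i + E i) =
  \sum_(i \in [set: I]) F i + \sum_(i \in [set: I]) E i.
Proof.
move=> fF fE; have fD : finite_set (supp F `|` supp E) by rewrite finite_setU.
rewrite (@fsumT_widen _ (supp F `|` supp E)); last first.
  move=> i; rewrite /supp /=; have [->|//] := eqVneq (F i) 0; last by left.
  by rewrite add0r; right.
rewrite (@fsumT_widen F (supp F `|` supp E)); last by move=> i; left.
rewrite (@fsumT_widen E (supp F `|` supp E)); last by move=> i; right.
by rewrite fsbig_split.
Qed.

Lemma fsumT_morph (W : zmodType) (u : V -> W) F :
  u 0 = 0 -> {morph u : x y / x + y} -> finite_set (supp F) ->
  u (\sum_(i \in [set: I]) F i) = \sum_(i \in [set: I]) u (F i).
Proof.
move=> u0 uD fF; rewrite (@fsumT_widen F (supp F)) //.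
have -> : \sum_(i \in [set: I]) u (F i) = \sum_(i \in supp F) u (F i).
  apply/esym/fsbig_widen => // i [_] /= /negP; rewrite negbK => /eqP ->.
  by rewrite u0.
by rewrite !fsbig_finite // (big_morph u uD u0).
Qed.

End FsumFacts.

Lemma fsumT1 (V : zmodType) (I : choiceType) (i : I) (F : I -> V) :
  (forall j, j != i -> F j = 0) -> \sum_(j \in [set: I]) F j = F i.
Proof.
move=> F0; rewrite (@fsumT_widen _ _ F [set i]) ?fsbig_set1 // => j.
by rewrite /supp /=; apply: contra_neq_eq => /F0.
Qed.

Lemma fsumT0 (V : zmodType) (I : choiceType) (F : I -> V) :
  (forall j, F j = 0) -> \sum_(j \in [set: I]) F j = 0.
Proof. by move=> F0; apply: fsbig1. Qed.

Section Convolution.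
Variables (R : nzRingType) (G : groupType) (Phi : supports G).
Implicit Types f g w : G -> R.

Lemma conv_supp f g : supp (conv f g) `<=`
  [set x | exists2 a, supp f a & exists2 b, supp g b & x = (a * b)%g].
Proof.
move=> x; rewrite /supp /= => nz.
have [h fgn0] : exists h, f h * g (h^-1 * x)%g != 0.
  apply: contrapT => nex; move: nz; rewrite /conv fsumT0 ?eqxx // => h.
  by apply/eqP; apply: contra_notT nex => ?; exists h.
exists h; first by apply: contra_neq fgn0 => ->; rewrite mul0r.
exists (h^-1 * x)%g; last by rewrite mulgA mulgV mul1g.
by apply: contra_neq fgn0 => ->; rewrite mulr0.
Qed.

Lemma conv_summand f g x : Phi (supp f) -> Phi (supp g) ->
  finite_set (supp (fun h => f h * g (h^-1 * x)%g)).
Proof.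
move=> sf sg; apply: sub_finite_set (small_fiber x sf sg) => h.
rewrite /supp /= => nz; split; apply: contra_neq nz => ->.
  by rewrite mul0r.
by rewrite mulr0.
Qed.

Lemma convA f g w : Phi (supp f) -> Phi (supp g) -> Phi (supp w) ->
  conv f (conv g w) = conv (conv f g) w.
Proof.
move=> sf sg sw; apply/funext => x.
pose F k h := f k * g (k^-1 * h)%g * w (h^-1 * x)%g.
pose AB := [set y | exists2 a, supp f a & exists2 b, supp g b & y = (a * b)%g].
pose D := [set h | AB h /\ supp w (h^-1 * x)%g].
have fD : finite_set D by apply: small_fiber (small_mul sf sg) sw.
pose E := \bigcup_(h in D) [set k | supp f k /\ supp g (k^-1 * h)%g].
have fE : finite_set E.
  by apply: bigcup_finite => // h _; apply: small_fiber sf sg.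
have FDE k h : F k h != 0 -> D h /\ E k.
  rewrite /F => nz.
  have fk : supp f k by apply: contra_neq nz => ->; rewrite !mul0r.
  have gk : supp g (k^-1 * h)%g.
    by apply: contra_neq nz => ->; rewrite mulr0 mul0r.
  have wh : supp w (h^-1 * x)%g by apply: contra_neq nz => ->; rewrite mulr0.
  have Dh : D h.
    by split=> //; exists k => //; exists (k^-1 * h)%g; rewrite // mulgA mulgV mul1g.
  by split=> //; exists h.
transitivity (\sum_(k \in E) \sum_(h \in D) F k h).
  have inner k : f k * conv g w (k^-1 * x)%g = \sum_(h \in D) F k h.
    rewrite /conv (@fsumT_morph _ _ _ ( *%R (f k))) ?mulr0 //; last 2 first.
    - exact: mulrDr.
    - exact: conv_summand.
    rewrite (reindex_fsbigT (fun h => k^-1 * h)%g); last first.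
      by exists (mul k) => h; rewrite mulgA ?mulgV ?mulVg mul1g.
    rewrite -(@fsumT_widen _ _ (F k) D); last by move=> h /FDE[].
    apply: eq_fsbigr => h _; rewrite /F mulrA; congr (_ * w _).
    by rewrite invgM invgK -!mulgA (mulgA k) mulgV mul1g.
  rewrite /conv; under eq_fsbigr do rewrite inner.
  apply: fsumT_widen => k; rewrite /supp /= => nz; apply: contrapT => nE.
  move: nz; rewrite fsbig1 ?eqxx // => h _; apply/eqP.
  by apply: contra_notT nE => /FDE[].
rewrite exchange_fsbig //.
have inner h : conv f g h * w (h^-1 * x)%g = \sum_(k \in E) F k h.
  rewrite /conv (@fsumT_morph _ _ _ ( *%R^~ (w (h^-1 * x)%g))) ?mul0r //; last 2 first.
  - by move=> a b; rewrite mulrDl.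
  - exact: conv_summand.
  by apply: (@fsumT_widen _ _ (F^~ h)) => k /FDE[].
rewrite {1}/conv; under [RHS]eq_fsbigr do rewrite inner.
apply/esym/fsumT_widen => h; rewrite /supp /= => nz; apply: contrapT => nD.
move: nz; rewrite fsbig1 ?eqxx // => k _; apply/eqP.
by apply: contra_notT nD => /FDE[].
Qed.

End Convolution.

Section FormalSeries.
Variables (R : nzRingType) (G : groupType) (Phi : supports G).

Definition fseries_pred : {pred G -> R} := fun f => `[< Phi (supp f) >].

Record fseries : predArgType :=
  FSeries { coef :> G -> R; coefP : coef \in fseries_pred }.

HB.instance Definition _ := [isSub for coef].
HB.instance Definition _ := [Choice of fseries by <:].

Lemma fseries_small (f : fseries) : Phi (supp f).
Proof. by case: f => f /= /asboolP. Qed.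

Fact fseries_zmod_closed : zmod_closed fseries_pred.
Proof.
split=> [|f g /asboolP sf /asboolP sg]; apply/asboolP.
  by apply: small_finite; rewrite (_ : supp _ = set0) // -subset0 => x /eqP.
apply: small_sub (small_setU sf sg) => x; rewrite /supp /=.
have [fx0 nz|] := eqVneq (f x) 0; last by left.
by right; apply: contra_neq nz => gx0; rewrite -[LHS]/(f x - g x) fx0 gx0 subrr.
Qed.

HB.instance Definition _ := GRing.isZmodClosed.Build _ _ fseries_zmod_closed.
HB.instance Definition _ := [SubChoice_isSubZmodule of fseries by <:].

Fact conv_small (f g : fseries) : conv f g \in fseries_pred.
Proof.
apply/asboolP; apply: small_sub (@conv_supp _ _ f g) _.
by apply: small_mul; apply: fseries_small.
Qed.

Definition fseries_one_fun : G -> R := fun g => (g == 1%g)%:R.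

Fact fseries_one_small : fseries_one_fun \in fseries_pred.
Proof.
apply/asboolP/small_finite/(sub_finite_set _ (finite_set1 1%g)) => g.
by rewrite /supp /fseries_one_fun /=; case: (eqVneq g 1%g) => // _; rewrite eqxx.
Qed.

Definition fseries_one : fseries := FSeries fseries_one_small.
Definition fseries_mul (f g : fseries) : fseries := FSeries (conv_small f g).

Fact fseries_mulA : associative fseries_mul.
Proof. by move=> f g h; apply/val_inj/(@convA _ _ Phi); apply: fseries_small. Qed.

Lemma conv1l (f : G -> R) : conv fseries_one_fun f = f.
Proof.
apply/funext => x; rewrite /conv (fsumT1 (i := 1%g)).
  by rewrite /fseries_one_fun eqxx mul1r invg1 mul1g.
by move=> h /negPf h1; rewrite /fseries_one_fun h1 mul0r.
Qed.

Lemma conv1r (f : G -> R) : conv f fseries_one_fun = f.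
Proof.
apply/funext => x; rewrite /conv (fsumT1 (i := x)).
  by rewrite /fseries_one_fun mulVg eqxx mulr1.
move=> h hx; rewrite /fseries_one_fun; case: eqP => [e|]; last by rewrite mulr0.
by case/eqP: hx; rewrite -[x](mulVKg h) e mulg1.
Qed.

Fact fseries_mul1 : left_id fseries_one fseries_mul.
Proof. by move=> f; apply/val_inj/conv1l. Qed.

Fact fseries_mulr1 : right_id fseries_one fseries_mul.
Proof. by move=> f; apply/val_inj/conv1r. Qed.

Lemma convDl (f g w : G -> R) : Phi (supp f) -> Phi (supp g) -> Phi (supp w) ->
  conv (f + g) w = conv f w + conv g w.
Proof.
move=> sf sg sw; apply/funext => x; rewrite -[RHS]/(conv f w x + conv g w x) /conv -fsumTD.
- by apply: eq_fsbigr => h _; rewrite -mulrDl.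
- exact: conv_summand sf sw.
- exact: conv_summand sg sw.
Qed.

Lemma convDr (f g w : G -> R) : Phi (supp f) -> Phi (supp g) -> Phi (supp w) ->
  conv w (f + g) = conv w f + conv w g.
Proof.
move=> sf sg sw; apply/funext => x; rewrite -[RHS]/(conv w f x + conv w g x) /conv -fsumTD.
- by apply: eq_fsbigr => h _; rewrite -mulrDr.
- exact: conv_summand sw sf.
- exact: conv_summand sw sg.
Qed.

Fact fseries_mulDl : left_distributive fseries_mul +%R.
Proof. by move=> f g w; apply/val_inj/convDl; apply: fseries_small. Qed.

Fact fseries_mulDr : right_distributive fseries_mul +%R.
Proof. by move=> w f g; apply/val_inj/convDr; apply: fseries_small. Qed.

Fact fseries_one_neq0 : fseries_one != 0.
Proof.
apply/eqP => /(congr1 (fun f : fseries => f 1%g)) /= /eqP.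
by rewrite /fseries_one_fun eqxx oner_eq0.
Qed.

HB.instance Definition _ := GRing.Zmodule_isNzRing.Build fseries fseries_mulA
  fseries_mul1 fseries_mulr1 fseries_mulDl fseries_mulDr fseries_one_neq0.

End FormalSeries.

Section GroupRing.
Variable G : groupType.

Fact fin_mul (A B : set G) : finite_set A -> finite_set B ->
  finite_set [set x | exists2 a, A a & exists2 b, B b & x = (a * b)%g].
Proof.
move=> fA fB; rewrite (_ : [set _ | _] = (fun p => p.1 * p.2)%g @` (A `*` B)).
  by apply: finite_image; apply: finite_setX.
apply/seteqP; split=> [x [a Aa [b Bb ->]]|x [[a b] [Aa Bb] <-]].
  by exists (a, b).
by exists a => //; exists b.
Qed.

Definition finite_supports : supports G.
Proof.
refine (@Supports G (@finite_set G) _ _ _ fin_mul _).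
- by move=> A B AB; apply: sub_finite_set.
- by move=> A B fA fB; rewrite finite_setU.
- by [].
- by move=> A B x fA _; apply: sub_finite_set fA => h [].
Defined.

End GroupRing.

Notation group_ring R G := (fseries R (finite_supports G)).

Lemma group_ring_finite (R : nzRingType) (G : groupType) (a : group_ring R G) :
  finite_set (supp a).
Proof. exact: (fseries_small a). Qed.

Section ModuleOverGroupRing.
Variables (R : nzRingType) (G : groupType) (Phi : supports G).

Fact group_ring_small (a : group_ring R G) : coef a \in fseries_pred Phi.
Proof. exact/asboolP/small_finite/group_ring_finite. Qed.

Definition of_group_ring (a : group_ring R G) : fseries R Phi :=
  FSeries (group_ring_small a).

Fact of_group_ring_zmod : zmod_morphism of_group_ring.
Proof. by move=> a b; apply/val_inj. Qed.
Fact of_group_ring_monoid : monoid_morphism of_group_ring.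
Proof. by split=> [|a b]; apply/val_inj. Qed.
HB.instance Definition _ := GRing.isZmodMorphism.Build (group_ring R G)
  (fseries R Phi) of_group_ring of_group_ring_zmod.
HB.instance Definition _ := GRing.isMonoidMorphism.Build (group_ring R G)
  (fseries R Phi) of_group_ring of_group_ring_monoid.

Definition gr_scale (a : group_ring R G) (x : fseries R Phi) : fseries R Phi :=
  of_group_ring a * x.

Fact gr_scaleA a b x : gr_scale a (gr_scale b x) = gr_scale (a * b) x.
Proof. by rewrite /gr_scale rmorphM mulrA. Qed.
Fact gr_scale1 : left_id 1 gr_scale.
Proof. by move=> x; rewrite /gr_scale rmorph1 mul1r. Qed.
Fact gr_scaleDr : right_distributive gr_scale +%R.
Proof. by move=> a x y; rewrite /gr_scale mulrDr. Qed.
Fact gr_scaleDl x : {morph gr_scale^~ x : a b / a + b}.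
Proof. by move=> a b; rewrite /gr_scale rmorphD mulrDl. Qed.
HB.instance Definition _ := GRing.Zmodule_isLmodule.Build (group_ring R G)
  (fseries R Phi) gr_scaleA gr_scale1 gr_scaleDr gr_scaleDl.

End ModuleOverGroupRing.

Definition trivial_module (R : nzRingType) (G : groupType) : Type := R.
HB.instance Definition _ R G :=
  GRing.Zmodule.copy (trivial_module R G) R.

Section TrivialModule.
Variables (R : nzRingType) (G : groupType).

Definition augmentation (a : group_ring R G) : R := \sum_(g \in [set: G]) a g.

Fact augmentationD : {morph augmentation : a b / a + b}.
Proof.
by move=> a b; rewrite /augmentation -fsumTD //; apply: group_ring_finite.
Qed.

Fact augmentationM : {morph augmentation : a b / a * b}.
Proof.
move=> a b; rewrite /augmentation.
have fa := group_ring_finite a; have fb := group_ring_finite b.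
pose AB := [set x | exists2 g, supp a g & exists2 h, supp b h & x = (g * h)%g].
have fAB : finite_set AB by apply: fin_mul.
rewrite (@fsumT_widen _ _ _ AB); last exact: conv_supp.
rewrite (@fsumT_morph _ _ _ ( *%R^~ (\sum_(g \in [set: G]) b g))) ?mul0r //;
  last by move=> x y; rewrite mulrDl.
rewrite (@fsumT_widen _ _ (fun h => a h * _) (supp a)); last first.
  by move=> h; rewrite /supp /=; apply: contra_neq => ->; rewrite mul0r.
have -> : \sum_(x \in AB) (a * b) x =
    \sum_(x \in AB) \sum_(h \in supp a) a h * b (h^-1 * x)%g.
  apply: eq_fsbigr => x _; apply: fsumT_widen => h; rewrite /supp /=.
  by apply: contra_neq => ->; rewrite mul0r.
rewrite exchange_fsbig //.
apply: eq_fsbigr => h /set_mem ah.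
rewrite -(@fsumT_widen _ _ (fun x => a h * b (h^-1 * x)%g)); last first.
  move=> x; rewrite /supp /= => nz; exists h => //; exists (h^-1 * x)%g.
    by apply: contra_neq nz => ->; rewrite mulr0.
  by rewrite mulgA mulgV mul1g.
rewrite (reindex_fsbigT (mul h)) /=; last first.
  by exists (mul h^-1)%g => x; rewrite mulgA ?mulgV ?mulVg mul1g.
rewrite (@fsumT_morph _ _ _ ( *%R (a h))) ?mulr0 //; last exact: mulrDr.
by apply: eq_fsbigr => x _; rewrite mulgA mulVg mul1g.
Qed.

Fact augmentation1 : augmentation 1 = 1.
Proof.
rewrite /augmentation (fsumT1 (i := 1%g)) /= /fseries_one_fun ?eqxx // => g.
by move=> /negPf ->.
Qed.

Definition triv_scale (a : group_ring R G) (r : trivial_module R G) :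
  trivial_module R G := augmentation a * (r : R).

Fact triv_scaleA a b r : triv_scale a (triv_scale b r) = triv_scale (a * b) r.
Proof. by rewrite /triv_scale augmentationM mulrA. Qed.
Fact triv_scale1 : left_id 1 triv_scale.
Proof. by move=> r; rewrite /triv_scale augmentation1 mul1r. Qed.
Fact triv_scaleDr : right_distributive triv_scale +%R.
Proof. by move=> a r s; rewrite /triv_scale mulrDr. Qed.
Fact triv_scaleDl r : {morph triv_scale^~ r : a b / a + b}.
Proof. by move=> a b; rewrite /triv_scale augmentationD mulrDl. Qed.
HB.instance Definition _ := GRing.Zmodule_isLmodule.Build (group_ring R G)
  (trivial_module R G) triv_scaleA triv_scale1 triv_scaleDr triv_scaleDl.

End TrivialModule.
Record character (G : groupType) (RR : realType) := Character {
  char_fun :> G -> RR;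
  charM : {morph char_fun : x y / (x * y)%g >-> x + y}
}.

Section Characters.
Variables (G : groupType) (RR : realType).
Implicit Type chi : character G RR.

Lemma char1 chi : chi 1%g = 0.
Proof. by apply: (addrI (chi 1%g)); rewrite -charM mulg1 addr0. Qed.

Lemma charV chi x : chi x^-1%g = - chi x.
Proof. by apply: (addrI (chi x)); rewrite -charM mulgV char1 subrr. Qed.

Definition nontrivial chi : Prop := exists g, chi g <> 0.

Fact opp_charM chi : {morph (fun g => - chi g) : x y / (x * y)%g >-> x + y}.
Proof. by move=> x y; rewrite charM opprD. Qed.
Definition opp_char chi : character G RR := Character (opp_charM chi).

Record char_ker chi : predArgType := CharKer {
  ker_val :> G;
  ker_valP : chi ker_val == 0
}.
HB.instance Definition _ chi := [isSub for @ker_val chi].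
HB.instance Definition _ chi := [Choice of char_ker chi by <:].
Fact char_ker_group_closed chi : group_closed (fun g : G => chi g == 0).
Proof.
split=> [|x y]; first by apply/eqP/char1.
by move=> /eqP x0 /eqP y0; apply/eqP; rewrite charM charV x0 y0 subrr.
Qed.
HB.instance Definition _ chi := SubChoice_isSubGroup.Build G _ (char_ker chi)
  (char_ker_group_closed chi).

Definition novikov_small chi (A : set G) : Prop :=
  forall r : RR, finite_set [set g | A g /\ chi g <= r].

Lemma novikov_lbound chi A : novikov_small chi A ->
  exists m, forall g, A g -> m <= chi g.
Proof.
move=> /(_ 0) fA; pose B := chi @` [set g | A g /\ chi g <= 0].
have fB : finite_set B by apply: finite_image.
exists (\big[Order.min/0]_(x <- fset_set B) x) => g Ag.
have [g0|/ltW g0] := leP (chi g) 0.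
  by apply: ge_bigmin_seq => //; rewrite in_fset_set // inE; exists g.
by apply: le_trans g0; apply: bigmin_le_id.
Qed.

Fact novikov_small_mul chi A B : novikov_small chi A -> novikov_small chi B ->
  novikov_small chi [set x | exists2 a, A a & exists2 b, B b & x = (a * b)%g].
Proof.
move=> sA sB r; have [mA lA] := novikov_lbound sA.
have [mB lB] := novikov_lbound sB.
apply: sub_finite_set (fin_mul (sA (r - mB)) (sB (r - mA))) => x.
move=> [[a Aa [b Bb ->]]]; rewrite charM => abr.
exists a; first by split=> //; rewrite lerBrDr (le_trans _ abr) // lerD2l lB.
by exists b => //; split=> //; rewrite lerBrDr addrC (le_trans _ abr) // lerD2r lA.
Qed.

Fact novikov_small_fiber chi A B x : novikov_small chi A ->
  novikov_small chi B -> finite_set [set h | A h /\ B (h^-1 * x)%g].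
Proof.
move=> sA sB; have [m lB] := novikov_lbound sB.
apply: sub_finite_set (sA (chi x - m)) => h [Ah /lB].
by rewrite charM charV => mx; split=> //; rewrite lerBrDr -lerBrDl addrC.
Qed.

Definition novikov_supports chi : supports G.
Proof.
refine (@Supports G (novikov_small chi) _ _ _ (@novikov_small_mul chi)
  (@novikov_small_fiber chi)).
- move=> A B AB sB r; apply: sub_finite_set (sB r) => g [Ag gr].
  by split=> //; apply: AB.
- move=> A B sA sB r.
  apply: (@sub_finite_set _ _ ([set g | A g /\ chi g <= r] `|`
    [set g | B g /\ chi g <= r])).
    by move=> g [[Ag|Bg] gr]; [left|right].
  by rewrite finite_setU.
- by move=> A fA r; apply: sub_finite_set fA => g [].
Defined.

End Characters.

Notation novikov_ring R chi := (fseries R (novikov_supports chi)).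

Section Modules.
Variable S : nzRingType.

Definition surjective (U V : Type) (f : U -> V) : Prop :=
  forall v, exists u, f u = v.

Definition projective (P : lmodType S) : Prop :=
  forall (M N : lmodType S) (p : {linear M -> N}) (f : {linear P -> N}),
    surjective p -> exists h : {linear P -> M}, forall x, p (h x) = f x.

Definition finitely_generated (M : lmodType S) : Prop :=
  exists (k : nat) (e : 'I_k -> M),
    forall x, exists c : 'I_k -> S, x = \sum_(i < k) c i *: e i.

Record resolution (A : lmodType S) := Resolution {
  res_obj :> nat -> lmodType S;
  res_d : forall n, {linear res_obj n.+1 -> res_obj n};
  res_eps : {linear res_obj 0 -> A};
  res_surj : surjective res_eps;
  res_exact0 : forall x, res_eps x = 0 <-> exists y, res_d 0 y = x;
  res_exactS : forall n x, res_d n x = 0 <-> exists y, res_d n.+1 y = x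
}.

Definition projective_resolution A (P : resolution A) : Prop :=
  forall n, projective (P n).

Definition length_le A (P : resolution A) (n : nat) : Prop :=
  forall k, (n < k)%N -> forall x : P k, x = 0.

End Modules.

(* [cohomology P M n] is the n-th cohomology group of Hom(P_*, M), where the
   augmentation P_0 -> A is deleted. *)
Section Cohomology.
Variables (S : nzRingType) (A : lmodType S) (P : resolution A).
Variables (M : lmodType S) (n : nat).

Definition cocycle_pred : {pred P n -> M} :=
  fun f => `[< linear f /\ forall y, f (res_d P n y) = 0 >].

Record cocycle : predArgType :=
  Cocycle { cocycle_fun :> P n -> M; _ : cocycle_fun \in cocycle_pred }.

HB.instance Definition _ := [isSub for cocycle_fun].
HB.instance Definition _ := [Choice of cocycle by <:].

Fact cocycle_zmod_closed : zmod_closed cocycle_pred.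
Proof.
split=> [|f g /asboolP[lf f0] /asboolP[lg g0]]; apply/asboolP; split=> //=.
- by move=> a x y; rewrite scaler0 addr0.
- move=> a x y; rewrite -![(f - g) _]/(f _ - g _) lf lg.
  by rewrite scalerBr opprD addrACA.
- by move=> y; rewrite -[LHS]/(f _ - g _) f0 g0 subrr.
Qed.
HB.instance Definition _ := GRing.isZmodClosed.Build _ _ cocycle_zmod_closed.
HB.instance Definition _ := [SubChoice_isSubZmodule of cocycle by <:].

Definition is_coboundary : (P n -> M) -> Prop :=
  match n return (P n -> M) -> Prop with
  | 0 => fun f => forall x, f x = 0
  | m.+1 => fun f => exists h : {linear P m -> M}, forall x, f x = h (res_d P m x)
  end.

Fact is_coboundary0 : is_coboundary (fun => 0).
Proof. by rewrite /is_coboundary; case: n => [|m] //; exists \0. Qed.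

Fact is_coboundaryB f g :
  is_coboundary f -> is_coboundary g -> is_coboundary (fun x => f x - g x).
Proof.
rewrite /is_coboundary; case: n f g => [|m] f g.
  by move=> f0 g0 x; rewrite f0 g0 subrr.
by move=> [h hf] [k kg]; exists (h \- k) => x; rewrite hf kg.
Qed.

Definition coboundary : {pred cocycle} := fun f => `[< is_coboundary f >].

Fact coboundary_zmod_closed : zmod_closed coboundary.
Proof.
split=> [|f g /asboolP Bf /asboolP Bg]; apply/asboolP.
  exact: is_coboundary0.
exact: is_coboundaryB Bf Bg.
Qed.
HB.instance Definition _ := GRing.isZmodClosed.Build _ _ coboundary_zmod_closed.

Definition cohomology : zmodType := Quotient.quot coboundary.

End Cohomology.

Section FreeModule.
Variables (S : nzRingType) (X : choiceType).

Definition free_pred : {pred X -> S^o} := fun f => `[< finite_set (supp f) >].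

Record free_module : predArgType :=
  FreeElt { free_coef :> X -> S^o; free_coefP : free_coef \in free_pred }.
HB.instance Definition _ := [isSub for free_coef].
HB.instance Definition _ := [Choice of free_module by <:].

Lemma free_finite (f : free_module) : finite_set (supp f).
Proof. by case: f => f /= /asboolP. Qed.

Fact free_submod_closed : submod_closed free_pred.
Proof.
split=> [|a f g /asboolP sf /asboolP sg]; apply/asboolP.
  by rewrite (_ : supp _ = set0) // -subset0 => x /eqP.
have fU : finite_set (supp f `|` supp g) by rewrite finite_setU.
apply: sub_finite_set fU => x; rewrite /supp /=.
have [fx0 nz|] := eqVneq (f x) 0; last by left.
right; apply: contra_neq nz => gx0.
by rewrite -[LHS]/(a *: f x + g x) fx0 gx0 scaler0 addr0.
Qed.
HB.instance Definition _ := GRing.isSubmodClosed.Build _ _ _ free_submod_closed.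
HB.instance Definition _ := [SubChoice_isSubLmodule of free_module by <:].

Variables (M : lmodType S) (m : X -> M).

Definition free_ext (f : free_module) : M := \sum_(x \in [set: X]) f x *: m x.

Fact free_ext_linear : linear free_ext.
Proof.
have fin (f : free_module) : finite_set (supp (fun x => f x *: m x)).
  apply: sub_finite_set (free_finite f) => x; rewrite /supp /=.
  by apply: contra_neq => ->; rewrite scale0r.
move=> a f g; rewrite /free_ext.
rewrite (@fsumT_morph _ _ _ ( *:%R a)) ?scaler0 //; last exact: scalerDr.
rewrite -fsumTD //; last first.
  apply: sub_finite_set (fin f) => x; rewrite /supp /=.
  by apply: contra_neq => ->; rewrite scaler0.
apply: eq_fsbigr => x _.
by rewrite -[_ x]/(a *: f x + g x) scalerDl scalerA.
Qed.
HB.instance Definition _ := GRing.isLinear.Build S free_module M *:%R free_ext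
  free_ext_linear.

Definition free_delta_fun (x : X) : X -> S^o := fun y => (y == x)%:R.
Fact free_delta_finite x : free_delta_fun x \in free_pred.
Proof.
apply/asboolP/(sub_finite_set _ (finite_set1 x)) => y.
by rewrite /supp /free_delta_fun /=; case: (eqVneq y x) => // _; rewrite eqxx.
Qed.
Definition free_delta x : free_module := FreeElt (free_delta_finite x).

Lemma free_ext_delta x : free_ext (free_delta x) = m x.
Proof.
rewrite /free_ext (fsumT1 (i := x)) /= /free_delta_fun ?eqxx ?scale1r // => y.
by move=> /negPf ->; rewrite scale0r.
Qed.

End FreeModule.

Lemma free_decomp (S : nzRingType) (X : choiceType) (f : free_module S X) :
  f = \sum_(x <- fset_set (supp f)) (f x : S) *: free_delta S x.
Proof.
apply/val_inj/funext => y.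
rewrite (raddf_sum (val : free_module S X -> _)) fct_sumE.
transitivity (\sum_(x <- fset_set (supp f)) f x *: free_delta_fun S x y); last first.
  by apply: eq_bigr => x _.
rewrite -fsbig_finite; last exact: free_finite.
rewrite -(@fsumT_widen _ _ (fun x => f x *: free_delta_fun S x y)).
  rewrite (fsumT1 (i := y)).
    by rewrite /free_delta_fun eqxx -[RHS]/(f y * 1) mulr1.
  by move=> x; rewrite /free_delta_fun eq_sym => /negPf ->; rewrite scaler0.
by move=> x; rewrite /supp /=; apply: contra_neq => ->; rewrite scale0r.
Qed.

Lemma free_projective (S : nzRingType) (X : choiceType) :
  projective (free_module S X : lmodType S).
Proof.
move=> M N p f p_surj.
have /choice[m pm] : forall x, exists u, p u = f (free_delta S x).
  by move=> x; apply: p_surj.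
exists (free_ext m) => g; rewrite (free_decomp g).
rewrite [X in p X]linear_sum. rewrite linear_sum [RHS]linear_sum.
apply: eq_bigr => x _; rewrite [X in p X]linearZ linearZ [RHS]linearZ /=.
by rewrite free_ext_delta pm.
Qed.

Section Kernel.
Variables (S : nzRingType) (U V : lmodType S) (f : {linear U -> V}).

Definition ker_pred : {pred U} := fun x => f x == 0.
Record ker_module : predArgType :=
  KerElt { ker_elt :> U; ker_eltP : ker_elt \in ker_pred }.
HB.instance Definition _ := [isSub for ker_elt].
HB.instance Definition _ := [Choice of ker_module by <:].
Fact ker_submod_closed : submod_closed ker_pred.
Proof.
split=> [|a x y /eqP x0 /eqP y0]; apply/eqP; first exact: linear0.
by rewrite linearP x0 y0 scaler0 addr0.
Qed.
HB.instance Definition _ := GRing.isSubmodClosed.Build _ _ _ ker_submod_closed.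
HB.instance Definition _ := [SubChoice_isSubLmodule of ker_module by <:].

End Kernel.

(* [syzygy A 0 = A] and [syzygy A n.+1] is the kernel of the surjection onto
   [syzygy A n] of the free module on the set of its elements. *)
Section FreeResolution.
Variables (S : nzRingType) (A : lmodType S).

Definition free_cover (M : lmodType S) : {linear free_module S M -> M} :=
  free_ext (@id M).

Fixpoint syzygy (n : nat) : lmodType S :=
  if n is m.+1 then ker_module (free_cover (syzygy m)) else A.

Definition free_d (n : nat) :
    {linear free_module S (syzygy n.+1) -> free_module S (syzygy n)} :=
  (val : ker_module (free_cover (syzygy n)) -> _) \o free_cover (syzygy n.+1).

Lemma free_cover_surj M : surjective (free_cover M).
Proof. by move=> x; exists (free_delta S x); apply: free_ext_delta. Qed.

Lemma free_d_exact n x :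
  free_cover (syzygy n) x = 0 <-> exists y, free_d n y = x.
Proof.
split=> [x0|[y <-]]; last first.
  by apply/eqP; apply: (ker_eltP (free_cover (syzygy n.+1) y)).
have kx : x \in ker_pred (free_cover (syzygy n)) by apply/eqP.
have [y yx] := free_cover_surj (KerElt kx : syzygy n.+1).
by exists y; rewrite /= -[LHS]/(val (free_cover (syzygy n.+1) y)) yx.
Qed.

Lemma free_d_exactS n x : free_d n x = 0 <-> exists y, free_d n.+1 y = x.
Proof.
rewrite -free_d_exact; split=> [x0|x0]; first exact/val_inj.
by rewrite -[LHS]/(val (free_cover (syzygy n.+1) x)) x0.
Qed.

Definition free_resolution : resolution A :=
  @Resolution S A (fun n => free_module S (syzygy n)) free_d
    (free_cover (syzygy 0)) (free_cover_surj (M := A)) (free_d_exact (n := 0))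
    free_d_exactS.

Lemma free_resolution_projective : projective_resolution free_resolution.
Proof. by move=> n; apply: free_projective. Qed.

End FreeResolution.

Definition Ext (S : nzRingType) (n : nat) (A M : lmodType S) : zmodType :=
  cohomology (free_resolution A) M n.

Definition group_cohomology (R : nzRingType) (G : groupType) (n : nat)
    (M : lmodType (group_ring R G)) : zmodType :=
  Ext n (trivial_module R G) M.

Definition type_FP (R : nzRingType) (G : groupType) : Prop :=
  exists (P : resolution (trivial_module R G)) (n : nat),
    [/\ projective_resolution P, forall k, finitely_generated (P k)
      & length_le P n].

Definition cd_le (R : nzRingType) (G : groupType) (n : nat) : Prop :=
  exists P : resolution (trivial_module R G),
    projective_resolution P /\ length_le P n.

Definition cd (R : nzRingType) (G : groupType) : \bar int :=
  if pselect (exists n, `[< cd_le R G n >]) is left ex_n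
  then (Posz (ex_minn ex_n))%:E else +oo%E.

Lemma cdP (R : nzRingType) (G : groupType) (n : nat) :
  cd R G = (Posz n)%:E <->
  cd_le R G n /\ forall m, cd_le R G m -> (n <= m)%N.
Proof.
rewrite /cd; case: pselect => [h|h]; last first.
  by split=> [//|[h1 _]]; case: h; exists n; apply/asboolP.
case: ex_minnP => k /asboolP kP kmin; split.
  by move=> [<-]; split=> // m mP; apply: kmin; apply/asboolP.
move=> [nP nmin]; congr (_%:E); congr Posz; apply/eqP; rewrite eqn_leq nmin //.
by rewrite kmin //; apply/asboolP.
Qed.

(* Main.v *)
Require Import Defs.
From HB Require Import structures.
From mathcomp Require Import all_boot all_order all_algebra.
From mathcomp Require Import monoid.
From mathcomp Require Import all_classical reals ereal.
Import Order.TTheory GRing.Theory Num.Theory.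
Set Implicit Arguments.
Unset Strict Implicit.
Unset Printing Implicit Defensive.
Local Open Scope classical_set_scope.
Local Open Scope ring_scope.

(* Let [Q] be a projective resolution of length [n] over [S = R[G]], and [K] the
   kernel of [chi].  Every [S]-linear [c : Q_n -> S] is a cocycle, so both its
   compositions with the inclusions of [S] in the two Novikov rings extend along
   [d : Q_n -> Q_{n-1}] to [b+] and [b-].  Series in the [chi]-completion have
   finitely many terms with [chi < 0], those in the [-chi]-completion finitely
   many with [chi >= 0], and cutting a series at a level of [chi] is
   [R[K]]-linear.  So the [chi < 0] part of [b+] plus the [chi >= 0] part of
   [b-] is an [R[K]]-linear extension of [c] with values in [S].  Comparing [Q]
   with a resolution by finitely generated projectives, the identity of [Q_n] is,
   up to a map factoring through [d], a finite sum of maps [x |-> c x *: v].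
   Hence [d] has an [R[K]]-linear retraction [r], and replacing [Q_{n-1}] by
   [ker r] gives a resolution of length [n-1] over [R[K]]; if [n = 0], then
   [Q_0 = 0], which is absurd. *)

(** * Comparison of projective resolutions *)

Section Corestriction.
Variables (S : nzRingType) (P N L : lmodType S).
Variables (e : {linear N -> L}) (f : {linear P -> N}) (ef0 : forall x, e (f x) = 0).

Fact corestr_subproof x : f x \in ker_pred e.
Proof. exact/eqP. Qed.

Definition corestr (x : P) : ker_module e := KerElt (corestr_subproof x).

Fact corestr_linear : linear corestr.
Proof. by move=> a x y; apply/val_inj; rewrite /= linearP. Qed.

HB.instance Definition _ := GRing.isLinear.Build S P (ker_module e) *:%R corestr
  corestr_linear.

End Corestriction.

Section Projective.
Variable S : nzRingType.

(** Onto the kernel of [e] the map [d] is surjective, so corestricting both maps reduces the claim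
    to the defining property of [P]. *)
Lemma projective_lift_exact (P M N L : lmodType S)
    (d : {linear M -> N}) (e : {linear N -> L}) (f : {linear P -> N}) :
  projective P -> (forall x, e x = 0 <-> exists y, d y = x) ->
  (forall x, e (f x) = 0) -> exists g : {linear P -> M}, forall x, d (g x) = f x.
Proof.
move=> projP exact_e ef0; have ed0 x : e (d x) = 0 by apply/exact_e; exists x.
have [|g gP] := projP _ _ (corestr ed0) (corestr ef0).
  move=> [x ex]; have /exact_e[y yx] := eqP ex.
  by exists y; apply/val_inj.
by exists g => x; have /(congr1 val) := gP x.
Qed.

Lemma projective_retract (P Q : lmodType S) (i : {linear P -> Q})
    (r : {linear Q -> P}) :
  (forall x, r (i x) = x) -> projective Q -> projective P.
Proof.
move=> ri projQ M N p f p_surj.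
have [h hP] := projQ _ _ p (f \o r) p_surj.
by exists (h \o i) => x /=; rewrite hP /= ri.
Qed.

Lemma projective_free_section (P : lmodType S) : projective P ->
  exists s : {linear P -> free_module S P}, forall x, free_cover P (s x) = x.
Proof.
move=> projP; have [s sP] := projP _ _ (free_cover P) idfun (@free_cover_surj _ P).
by exists s => x; rewrite sP.
Qed.

(** Dual basis: the generators give a surjection from a free module of rank [k], and the [l i] are
    the coordinates of a section of it. *)
Lemma fg_projective_coordinates (P : lmodType S) :
  projective P -> finitely_generated P ->
  exists (k : nat) (e : 'I_k -> P) (l : 'I_k -> {linear P -> S^o}),
    forall x, x = \sum_(i < k) (l i x : S) *: e i.
Proof.
move=> projP [k [e eP]]; exists k, e.
have ext_linear : linear (fun c : {ffun 'I_k -> S^o} => \sum_(i < k) (c i : S) *: e i).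
  move=> a c c'; rewrite scaler_sumr -big_split; apply: eq_bigr => i _ /=.
  by rewrite !ffunE scalerDl scalerA.
pose ext := HB.pack_for {linear {ffun 'I_k -> S^o} -> P}
  (fun c : {ffun 'I_k -> S^o} => \sum_(i < k) (c i : S) *: e i)
  (GRing.isLinear.Build _ _ _ _ _ ext_linear).
have [|s sP] := projP _ _ ext idfun.
  move=> x; have [c ->] := eP x; exists [ffun i => c i].
  by apply: eq_bigr => i _; rewrite ffunE.
have coord_linear i : linear (fun x => s x i).
  by move=> a x y; rewrite linearP !ffunE.
exists (fun i => HB.pack_for {linear P -> S^o} (fun x => s x i)
  (GRing.isLinear.Build _ _ _ _ _ (coord_linear i))).
by move=> x; rewrite -[LHS](sP x).
Qed.

End Projective.

Section Comparison.
Variables (S : nzRingType) (A : lmodType S).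
Implicit Types P Q : resolution A.

(** The augmentation serves as the differential in degree 0, so that cycles are boundaries in every
    degree. *)
Definition is_cycle P n : P n -> Prop :=
  match n with
  | 0 => fun x => res_eps P x = 0
  | m.+1 => fun x => res_d P m x = 0
  end.

Lemma cycleP P n (x : P n) : is_cycle x <-> exists y, res_d P n y = x.
Proof. by case: n x => [|n] x; [apply: res_exact0|apply: res_exactS]. Qed.

Lemma cycle_d P n x : is_cycle (res_d P n x).
Proof. by apply/cycleP; exists x. Qed.

Lemma cycle_lift Q n (M : lmodType S) (f : {linear M -> Q n}) :
  projective M -> (forall x, is_cycle (f x)) ->
  exists h : {linear M -> Q n.+1}, forall x, res_d Q n (h x) = f x.
Proof.
move=> projM; case: n f => [|n] f f0.
  by apply: (projective_lift_exact projM _ f0) => x; apply: res_exact0.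
by apply: (projective_lift_exact projM _ f0) => x; apply: res_exactS.
Qed.

(** One degree of a homotopy equivalence. The homotopy identity is required on cycles only, where
    the term from the degree below vanishes; this permits induction on the degree without carrying
    full chain maps. *)
Definition cycle_equiv P Q n (f : {linear P n -> Q n}) (g : {linear Q n -> P n})
    (h : {linear Q n -> Q n.+1}) : Prop :=
  [/\ forall x, is_cycle x -> is_cycle (f x), forall x, is_cycle x -> is_cycle (g x)
    & forall x, is_cycle x -> res_d Q n (h x) = x - f (g x)].

Lemma cycle_equivS P Q n f g h :
  projective_resolution P -> projective_resolution Q -> @cycle_equiv P Q n f g h ->
  exists f' g' h', [/\ @cycle_equiv P Q n.+1 f' g' h',
    forall x, res_d P n (g' x) = g (res_d Q n x)
    & forall x, res_d Q n.+1 (h' x) = x - f' (g' x) - h (res_d Q n x)].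
Proof.
move=> projP projQ [fZ gZ hZ].
have [x|f' f'P] := @cycle_lift Q n _ (f \o res_d P n) (projP _).
  exact/fZ/cycle_d.
have [x|g' g'P] := @cycle_lift P n _ (g \o res_d Q n) (projQ _).
  exact/gZ/cycle_d.
(* The differential of this map at [x] is [y - f (g y) - d (h y)] with [y = d x], which vanishes by
   the identity for [h] at the cycle [y]. *)
have [x|h' h'P] := @cycle_lift Q n.+1 _
    (idfun \- (f' \o g') \- (h \o res_d Q n)) (projQ _).
  by rewrite /= !linearB f'P /= g'P /= hZ ?subrr //; apply: cycle_d.
exists f', g', h'; split=> //; split=> x /= x0.
- by rewrite f'P /= x0 linear0.
- by rewrite g'P /= x0 linear0.
- by rewrite h'P /= x0 linear0 subr0.
Qed.

Lemma cycle_equiv_exists P Q n :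
  projective_resolution P -> projective_resolution Q ->
  exists f g h, @cycle_equiv P Q n f g h.
Proof.
move=> projP projQ; elim: n => [|n [f [g [h fgh]]]]; last first.
  by have [f' [g' [h' []]]] := cycle_equivS projP projQ fgh; exists f', g', h'.
have [f fP] := projP 0 _ _ (res_eps Q) (res_eps P) (@res_surj _ _ Q).
have [g gP] := projQ 0 _ _ (res_eps P) (res_eps Q) (@res_surj _ _ P).
have [x|h hP] := @cycle_lift Q 0 _ (idfun \- (f \o g)) (projQ _).
  by rewrite /= linearB fP gP subrr.
exists f, g, h; split=> x /= x0.
- by rewrite fP.
- by rewrite gP.
- exact: hP.
Qed.

Lemma eq_coboundary Q n (M : lmodType S) (c b : Q n -> M) :
  c =1 b -> is_coboundary c -> is_coboundary b.
Proof. by move=> /funext ->. Qed.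

Lemma coboundaryD Q n (M : lmodType S) (c b : Q n -> M) :
  is_coboundary c -> is_coboundary b -> is_coboundary (fun x => c x + b x).
Proof.
move=> cB bB; apply: (@eq_coboundary _ _ _ (fun x => c x - (0 - b x))).
  by move=> x; rewrite sub0r opprK.
exact/(is_coboundaryB cB)/is_coboundaryB/bB/is_coboundary0.
Qed.

Lemma coboundary_sum Q n (M : lmodType S) (I : Type) (s : seq I) (c : I -> Q n -> M) :
  (forall i, is_coboundary (c i)) -> is_coboundary (fun x => \sum_(i <- s) c i x).
Proof.
move=> cB; elim: s => [|i s IHs].
  by apply: eq_coboundary (is_coboundary0 _ _ _) => x; rewrite big_nil.
by apply: eq_coboundary (coboundaryD (cB i) IHs) => x; rewrite big_cons.
Qed.

Lemma coboundary_comp Q n (M N : lmodType S) (u : {linear M -> N}) (c : Q n -> M) :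
  is_coboundary c -> is_coboundary (fun x => u (c x)).
Proof.
case: n c => [|n] c /= => [c0 x|[b bP]]; first by rewrite c0 linear0.
by exists (u \o b) => x /=; rewrite bP.
Qed.

(** The part of a homotopy equivalence that cohomology sees. Degree 0 is treated apart: no homotopy
    comes from below, and coboundaries are zero. *)
Lemma coboundary_equiv P Q n :
  projective_resolution P -> projective_resolution Q ->
  exists (f : {linear P n -> Q n}) (g : {linear Q n -> P n}),
  [/\ forall x, is_cycle x -> is_cycle (f x),
     forall (M : lmodType S) (c : P n -> M), is_coboundary c ->
       is_coboundary (fun x => c (g x))
   & forall (M : lmodType S) (c : {linear Q n -> M}),
       (forall y, c (res_d Q n y) = 0) -> is_coboundary (fun x => c x - c (f (g x)))].
Proof.
move=> projP projQ; case: n => [|n].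
  have [f fP] := projP 0 _ _ (res_eps Q) (res_eps P) (@res_surj _ _ Q).
  have [g gP] := projQ 0 _ _ (res_eps P) (res_eps Q) (@res_surj _ _ P).
  exists f, g; split=> [x /= x0|M c c0 x|M c cd x]; [by rewrite fP|exact: c0|].
  have /cycleP[y yx] : is_cycle (x - f (g x)) by rewrite /= linearB fP gP subrr.
  by rewrite -linearB -yx cd.
have [f [g [h fgh]]] := cycle_equiv_exists n projP projQ.
have [f' [g' [h' [[fZ gZ _] g'P h'P]]]] := cycle_equivS projP projQ fgh.
exists f', g'; split=> // [M c [b bP]|M c cd].
  by exists (b \o g) => x /=; rewrite bP g'P.
(* Applying the cocycle [c] to the homotopy identity kills the boundary of [h' x] and leaves
   [c \o h] as a primitive. *)
exists (c \o h) => x /=; rewrite -linearB.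
by apply/eqP; rewrite -subr_eq0 -linearB -h'P cd.
Qed.

Definition cohomology_vanishes Q n (M : lmodType S) : Prop :=
  forall c : {linear Q n -> M}, (forall y, c (res_d Q n y) = 0) -> is_coboundary c.

Lemma cohomology_eq0 Q n (M : lmodType S) :
  (forall x : cohomology Q M n, x = 0) -> cohomology_vanishes Q n M.
Proof.
move=> H0 c cd; have cP : (c : Q n -> M) \in @cocycle_pred _ _ Q M n.
  by apply/asboolP; split=> //; apply: linearP.
have : Cocycle cP - 0 \in @coboundary _ _ Q M n.
  by rewrite Quotient.idealrBE; apply/eqP; rewrite [LHS]H0 [RHS]H0.
by rewrite subr0 => /asboolP.
Qed.

(** Pull [c] back along [f], find a primitive over [P], and return along [g]; the round trip changes
    [c] by a coboundary. *)
Lemma cohomology_vanishes_indep P Q n (M : lmodType S) :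
  projective_resolution P -> projective_resolution Q ->
  cohomology_vanishes P n M -> cohomology_vanishes Q n M.
Proof.
move=> projP projQ P0 c cd.
have [f [g [fZ gB fgB]]] := coboundary_equiv n projP projQ.
apply: (@eq_coboundary _ _ _ (fun x => c x - c (f (g x)) + c (f (g x)))).
  by move=> x; rewrite subrK.
apply: coboundaryD (fgB _ _ cd) (gB _ (c \o f) _); apply: P0 => y /=.
by have /fZ/cycleP[z <-] := cycle_d y; rewrite cd.
Qed.

End Comparison.

(** * Shortening a resolution *)

Section Shortening.
Variable S : nzRingType.

Section Shift.
Variables (A : lmodType S) (Q : resolution A).

Fact res_eps_d x : res_eps Q (res_d Q 0 x) = 0.
Proof. by apply/res_exact0; exists x. Qed.

Fact shift_surj : surjective (corestr res_eps_d).
Proof.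
move=> [x x0]; have /res_exact0[y yx] := eqP x0.
by exists y; apply/val_inj.
Qed.

Fact shift_exact0 x : corestr res_eps_d x = 0 <-> exists y, res_d Q 1 y = x.
Proof.
rewrite -res_exactS; split=> [/(congr1 val)//|x0].
exact/val_inj.
Qed.

(** Removing [Q 0] lets the induction in [shorten_resolution] lower the degree of the retraction;
    [splice] puts [Q 0] back. *)
Definition shift_resolution : resolution (ker_module (res_eps Q)) :=
  @Resolution _ _ (fun n => Q n.+1) (fun n => res_d Q n.+1) (corestr res_eps_d)
    shift_surj shift_exact0 (fun n => @res_exactS _ _ Q n.+1).

Variable P : resolution (ker_module (res_eps Q)).

Definition splice_obj (n : nat) : lmodType S := if n is m.+1 then P m else Q 0.

Definition splice_d (n : nat) : {linear splice_obj n.+1 -> splice_obj n} :=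
  match n with
  | 0 => (val : ker_module (res_eps Q) -> _) \o res_eps P
  | m.+1 => res_d P m
  end.

Fact splice_exact0 x : res_eps Q x = 0 <-> exists y, splice_d 0 y = x.
Proof.
split=> [x0|[y <-]]; last exact/eqP/(ker_eltP (res_eps P y)).
have kx : x \in ker_pred (res_eps Q) by apply/eqP.
have [y yx] := @res_surj _ _ P (KerElt kx).
by exists y; rewrite /= -[LHS]/(val (res_eps P y)) yx.
Qed.

Fact splice_exactS n x : splice_d n x = 0 <-> exists y, splice_d n.+1 y = x.
Proof.
case: n x => [|n] x; last exact: res_exactS.
rewrite -(@res_exact0 _ _ P); split=> [x0|x0]; first exact/val_inj.
by rewrite -[LHS]/(val (res_eps P x)) x0.
Qed.

Definition splice : resolution A :=
  @Resolution _ _ splice_obj splice_d (res_eps Q) (@res_surj _ _ Q)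
    splice_exact0 splice_exactS.

End Shift.

Section KernelOfRetraction.
Variables (A : lmodType S) (Q : resolution A) (r : {linear Q 0 -> Q 1}).
Hypothesis rd : forall x, r (res_d Q 0 x) = x.

Definition zero_module : lmodType S := 'rV[S]_0.

Fact zero_module0 (x : zero_module) : x = 0.
Proof. by apply/matrixP => i []. Qed.

Lemma zero_projective : projective zero_module.
Proof. by move=> M N p f _; exists \0 => x; rewrite (zero_module0 x) !linear0. Qed.

Fact retract_proj_ker x : r (x - res_d Q 0 (r x)) = 0.
Proof. by rewrite linearB rd subrr. Qed.

(** Projection onto the kernel of [r] along the image of the differential. By this splitting the
    augmentation is an isomorphism from that kernel to [A], so the kernel alone resolves [A]. *)
Definition retract_proj : {linear Q 0 -> ker_module r} :=
  corestr (f := idfun \- (res_d Q 0 \o r)) retract_proj_ker.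

Definition ker_eps : {linear ker_module r -> A} :=
  res_eps Q \o (val : ker_module r -> _).

Fact ker_eps_surj : surjective ker_eps.
Proof.
move=> a; have [y ya] := @res_surj _ _ Q a.
by exists (retract_proj y); rewrite /= linearB res_eps_d subr0.
Qed.

Definition ker_obj (n : nat) : lmodType S :=
  if n is 0 then ker_module r else zero_module.

Definition ker_d (n : nat) : {linear ker_obj n.+1 -> ker_obj n} := \0.

Fact ker_exact0 x : ker_eps x = 0 <-> exists y, ker_d 0 y = x.
Proof.
split=> [/res_exact0[y yx]|[y <-]]; last by rewrite linear0.
exists 0; rewrite linear0; apply/val_inj => /=.
have : r (ker_elt x) = 0 by apply/eqP/(ker_eltP x).
by rewrite -[ker_elt x]yx rd => ->; rewrite linear0.
Qed.

Fact ker_exactS n x : ker_d n x = 0 <-> exists y, ker_d n.+1 y = x.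
Proof. by rewrite (zero_module0 x); split=> // _; exists 0. Qed.

Definition ker_resolution : resolution A :=
  @Resolution _ _ ker_obj ker_d ker_eps ker_eps_surj ker_exact0 ker_exactS.

Lemma ker_resolution_projective :
  projective (Q 0) -> projective_resolution ker_resolution.
Proof.
move=> projQ [|n]; last exact: zero_projective.
apply: (@projective_retract _ (ker_module r) _ (val : ker_module r -> _)
  retract_proj) => // x.
apply/val_inj => /=; have -> : r (val x) = 0 by apply/eqP/(ker_eltP x).
by rewrite linear0 subr0.
Qed.

End KernelOfRetraction.

Lemma shorten_resolution (A : lmodType S) (Q : resolution A) (n : nat)
    (r : {linear Q n -> Q n.+1}) :
  projective_resolution Q -> (forall x, r (res_d Q n x) = x) ->
  exists P : resolution A, projective_resolution P /\ length_le P n.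
Proof.
elim: n A Q r => [|n IHn] A Q r projQ rd.
  exists (ker_resolution rd); split; first exact: ker_resolution_projective.
  by move=> [|k] // _ x; apply: zero_module0.
have [P [projP lenP]] := IHn _ (shift_resolution Q) r (fun n => projQ n.+1) rd.
exists (splice P); split=> [[|k]|[|k]] //; [exact: projQ|exact: projP|exact: lenP].
Qed.

End Shortening.

(** * Restriction of scalars to the kernel of a character *)

(** Keeping [f] in the type lets the module structure induced by [f] be inferred beside the one of
    [M]. *)
Definition restrict_scalars (S' S : nzRingType) (f : {rmorphism S' -> S})
  (M : lmodType S) : Type := M.

Section RestrictionOfScalars.
Variables (S' S : nzRingType) (f : {rmorphism S' -> S}).

Section RestrictedModule.
Variable M : lmodType S.

HB.instance Definition _ := GRing.Zmodule.copy (restrict_scalars f M) M.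

Definition restrict_scale (a : S') (x : restrict_scalars f M) : restrict_scalars f M :=
  f a *: (x : M).

Fact restrict_scaleA a b x :
  restrict_scale a (restrict_scale b x) = restrict_scale (a * b) x.
Proof. by rewrite /restrict_scale rmorphM scalerA. Qed.
Fact restrict_scale1 : left_id 1 restrict_scale.
Proof. by move=> x; rewrite /restrict_scale rmorph1 scale1r. Qed.
Fact restrict_scaleDr : right_distributive restrict_scale +%R.
Proof. by move=> a x y; apply: scalerDr. Qed.
Fact restrict_scaleDl x : {morph restrict_scale^~ x : a b / a + b}.
Proof. by move=> a b; rewrite /restrict_scale rmorphD; apply: scalerDl. Qed.
HB.instance Definition _ := GRing.Zmodule_isLmodule.Build S' (restrict_scalars f M)
  restrict_scaleA restrict_scale1 restrict_scaleDr restrict_scaleDl.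

Lemma restrict_scaleE (a : S') (x : restrict_scalars f M) : a *: x = f a *: (x : M).
Proof. by []. Qed.

End RestrictedModule.

Section RestrictedMap.
Variables (M N : lmodType S) (u : {linear M -> N}).

Definition restrict_map (x : restrict_scalars f M) : restrict_scalars f N := u x.

Fact restrict_map_linear : linear restrict_map.
Proof. by move=> a x y; rewrite /restrict_map; apply: linearP. Qed.

HB.instance Definition _ :=
  GRing.isLinear.Build S' (restrict_scalars f M) (restrict_scalars f N) *:%R restrict_map
    restrict_map_linear.

End RestrictedMap.

Definition restrict_resolution (A : lmodType S) (Q : resolution A) :
    resolution (restrict_scalars f A : lmodType S') :=
  @Resolution S' (restrict_scalars f A) (fun n => restrict_scalars f (Q n))
    (fun n => restrict_map (res_d Q n)) (restrict_map (res_eps Q))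
    (@res_surj _ _ Q) (@res_exact0 _ _ Q) (@res_exactS _ _ Q).

End RestrictionOfScalars.

Section KernelOfCharacter.
Variables (RR : realType) (R : nzRingType) (G : groupType) (chi : character G RR).
Local Notation K := (char_ker chi).

Lemma fsum_char_ker (V : zmodType) (F : G -> V) :
  (forall g, chi g != 0 -> F g = 0) ->
  \sum_(g \in [set: G]) F g = \sum_(k \in [set: K]) F (ker_val k).
Proof.
move=> F0; have val_inj_on : set_inj [set: K] (@ker_val _ _ chi).
  by move=> x y _ _; apply: val_inj.
rewrite -(fsbig_image _ _ _ val_inj_on).
apply/esym/fsbig_widen => // g [_ gK] /=; apply: F0; apply/negP => g0.
by apply: gK; exists (CharKer g0).
Qed.

Definition ext0 (a : K -> R) (g : G) : R :=
  if insub g is Some k then a k else 0.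

Lemma ext0_val a (k : K) : ext0 a (ker_val k) = a k.
Proof. by rewrite /ext0 (valK k). Qed.

Lemma ext0_out a g : chi g != 0 -> ext0 a g = 0.
Proof. by rewrite /ext0; case: insubP => // k ->. Qed.

(** The arguments of [y] on the right have the same [chi]-value as [g]; hence operations that cut
    along values of [chi] are linear over the group ring of the kernel. *)
Lemma conv_ext0 a (y : G -> R) g :
  conv (ext0 a) y g = \sum_(k \in [set: K]) a k * y ((ker_val k)^-1 * g)%g.
Proof.
rewrite /conv fsum_char_ker => [|h hK]; last by rewrite ext0_out ?mul0r.
by apply: eq_fsbigr => k _; rewrite ext0_val.
Qed.

Fact ext0_small (a : group_ring R K) : ext0 a \in fseries_pred (finite_supports G).
Proof.
apply/asboolP; apply: sub_finite_set
  (finite_image (@ker_val _ _ chi) (group_ring_finite a)) => g.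
rewrite /supp /= /ext0; case: insubP => [k _ <-|_]; last by rewrite eqxx.
by exists k.
Qed.

Definition ker_incl (a : group_ring R K) : group_ring R G := FSeries (ext0_small a).

Fact ker_incl_zmod : zmod_morphism ker_incl.
Proof.
move=> a b; apply/val_inj/funext => g.
rewrite -[RHS]/(ext0 a g - ext0 b g) /= /ext0.
by case: insubP => //; rewrite subr0.
Qed.

Fact ker_incl_monoid : monoid_morphism ker_incl.
Proof.
split=> [|a b]; apply/val_inj/funext => g.
  rewrite /= /ext0 /= /fseries_one_fun; case: insubP => [k _ <-|] //.
  by case: (eqVneq g 1%g) => // ->; rewrite char1 eqxx.
rewrite -[RHS]/(conv (ext0 a) (ext0 b) g) conv_ext0.
have [g0|g0] := boolP (chi g == 0); last first.
  rewrite /= ext0_out // fsumT0 // => k.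
  by rewrite ext0_out ?mulr0 // charM charV (eqP (ker_valP k)) oppr0 add0r.
transitivity (conv a b (CharKer g0)); first exact: ext0_val (CharKer g0).
by apply: eq_fsbigr => k _; congr (_ * _); rewrite -(ext0_val b).
Qed.

HB.instance Definition _ := GRing.isZmodMorphism.Build (group_ring R K)
  (group_ring R G) ker_incl ker_incl_zmod.
HB.instance Definition _ := GRing.isMonoidMorphism.Build (group_ring R K)
  (group_ring R G) ker_incl ker_incl_monoid.

Lemma augmentation_ker_incl a : augmentation (ker_incl a) = augmentation a.
Proof.
rewrite /augmentation fsum_char_ker => [|g]; last exact: ext0_out.
by apply: eq_fsbigr => k _; apply: ext0_val.
Qed.

(** Identifies the restricted trivial module with that of the kernel; linearity says that [ker_incl]
    preserves augmentations. *)
Definition restrict_trivial (x : restrict_scalars ker_incl (trivial_module R G)) :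
  trivial_module R K := x.

Fact restrict_trivial_linear : linear restrict_trivial.
Proof.
move=> a x y; rewrite /restrict_trivial restrict_scaleE.
by rewrite -[RHS]/(augmentation a * (x : R) + y) -augmentation_ker_incl.
Qed.

HB.instance Definition _ := GRing.isLinear.Build (group_ring R K)
  (restrict_scalars ker_incl (trivial_module R G)) (trivial_module R K) *:%R
  restrict_trivial restrict_trivial_linear.

Definition restrict_trivial_resolution (Q : resolution (trivial_module R G)) :
    resolution (trivial_module R K) :=
  @Resolution _ _ (restrict_resolution ker_incl Q)
    (fun n => res_d (restrict_resolution ker_incl Q) n)
    (restrict_trivial \o restrict_map (res_eps Q))
    (@res_surj _ _ Q) (@res_exact0 _ _ Q) (@res_exactS _ _ Q).

End KernelOfCharacter.

(** * Projectivity over the group ring of the kernel *)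

Section RestrictedProjective.
Variables (RR : realType) (R : nzRingType) (G : groupType) (chi : character G RR).
Local Notation K := (char_ker chi).
Local Notation res := (restrict_scalars (@ker_incl RR R G chi)).

Fact group_elt_small (t : G) :
  (fun g => (g == t)%:R : R) \in fseries_pred (finite_supports G).
Proof.
apply/asboolP/(sub_finite_set _ (finite_set1 t)) => g.
by rewrite /supp /=; case: (eqVneq g t) => // _; rewrite eqxx.
Qed.

Definition group_elt (t : G) : group_ring R G := FSeries (group_elt_small t).

Lemma conv_group_elt (y : G -> R) t g : conv y (group_elt t) g = y (g * t^-1)%g.
Proof.
rewrite /conv (fsumT1 (i := (g * t^-1)%g)) => [|h] /=.
  by rewrite invgM invgK -mulgA mulVg mulg1 eqxx mulr1.
case: (eqVneq (h^-1 * g)%g t) => [<-|_ _]; last by rewrite mulr0.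
by rewrite invgM invgK mulgA mulgV mul1g eqxx.
Qed.

(* Chooses one element in each coset of [ker chi], the cosets being indexed by
   the values of [chi]; junk if [c] is not a value of [chi]. *)
Definition transversal (c : RR) : G := xget 1%g [set g | chi g = c].

Lemma chi_transversal g : chi (transversal (chi g)) = chi g.
Proof. exact: (@xgetI _ _ [set h | chi h = chi g] g). Qed.

(** The coordinate of [a] on the coset of value [c]. The test discards each [c] that is not a value
    of [chi], where the representative is junk. *)
Definition slice_fun (c : RR) (a : G -> R) (k : K) : R :=
  if chi (transversal c) == c then a (ker_val k * transversal c)%g else 0.

Fact slice_small c (a : group_ring R G) :
  slice_fun c a \in fseries_pred (finite_supports K).
Proof.
apply/asboolP; apply: (@sub_finite_set _ _
  ((fun k : K => (ker_val k * transversal c)%g) @^-1` supp a)).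
  by move=> k; rewrite /supp /= /slice_fun; case: ifP => // _; rewrite eqxx.
apply: finite_preimage (group_ring_finite a) => x y _ _ /mulIg.
exact: val_inj.
Qed.

Definition slice c (a : group_ring R G) : group_ring R K := FSeries (slice_small c a).

Lemma slice_linear c (b : group_ring R K) (a a' : group_ring R G) :
  slice c (ker_incl b * a + a') = b * slice c a + slice c a'.
Proof.
apply/val_inj/funext => k; rewrite -[RHS]/(conv b (slice_fun c a) k + slice_fun c a' k).
rewrite /= /slice_fun; case: ifP => cT; last first.
  by rewrite addr0 /conv fsumT0 // => h; rewrite mulr0.
rewrite -[LHS]/(conv (ext0 b) a _ + a' _) conv_ext0; congr (_ + _).
by apply: eq_fsbigr => h _; rewrite mulgA.
Qed.

Lemma slice_eq0 c (a : group_ring R G) : ~ (chi @` supp a) c -> slice c a = 0.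
Proof.
move=> nc; apply/val_inj/funext => k /=; rewrite /slice_fun.
case: eqP => // cT; apply/eqP; apply: contra_notT nc => nz.
exists (ker_val k * transversal c)%g => //.
by rewrite charM cT (eqP (ker_valP k)) add0r.
Qed.

(** The group ring of [G] is a free left module over that of the kernel, with the coset
    representatives as basis: only the coset of value [chi g] contributes at [g]. *)
Lemma slice_sum (E : set RR) (a : group_ring R G) : finite_set E ->
  chi @` supp a `<=` E ->
  \sum_(c \in E) ker_incl (slice c a) * group_elt (transversal c) = a.
Proof.
move=> fE aE; apply/val_inj/funext => g.
have coefD : {morph (fun x : group_ring R G => coef x g) : x y / x + y} by [].
rewrite -[LHS]/(coef _ g) fsbig_finite //.
rewrite (big_morph _ coefD (erefl : coef 0 g = 0)) -fsbig_finite //.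
transitivity (\sum_(c \in E) (if c == chi g then a g else 0)).
  apply: eq_fsbigr => c _; rewrite -[LHS]/(conv _ (group_elt _) g) conv_group_elt /=.
  have [->|cg] := eqVneq c (chi g).
    have gK : chi (g * (transversal (chi g))^-1)%g == 0.
      by rewrite charM charV chi_transversal subrr.
    rewrite -[(g * _)%g]/(ker_val (CharKer gK)) ext0_val /slice_fun /=.
    by rewrite chi_transversal eqxx -mulgA mulVg mulg1.
  have [gK|] := boolP (chi (g * (transversal c)^-1)%g == 0); last exact: ext0_out.
  rewrite -[(g * _)%g]/(ker_val (CharKer gK)) ext0_val /slice_fun.
  case: eqP => // cT; case/eqP: cg; rewrite -cT.
  by move: gK; rewrite charM charV subr_eq0 => /eqP.
have [Eg|nEg] := pselect (E (chi g)).
  rewrite -(@fsbig_widen _ _ _ _ [set chi g]).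
  - by rewrite fsbig_set1 eqxx.
  - by move=> _ ->.
  by move=> c [_ /eqP /negPf] /= ->.
rewrite fsbig1; last by move=> c Ec; case: eqP => // cg; case: nEg; rewrite -cg.
by apply/esym/eqP; apply: contra_notT nEg => ag; apply: aE; exists g.
Qed.

Variable P : lmodType (group_ring R G).

Definition slices_fun (f : free_module (group_ring R G) P) (x : P * RR) :
  (group_ring R K)^o := slice x.2 (f x.1).

Definition slice_values (f : free_module (group_ring R G) P) : set RR :=
  \bigcup_(p in supp f) (chi @` supp (f p : group_ring R G)).

Lemma slice_values_finite f : finite_set (slice_values f).
Proof.
apply: bigcup_finite => [|p _]; first exact: free_finite.
exact/finite_image/group_ring_finite.
Qed.

Lemma slices_supp f : supp (slices_fun f) `<=` supp f `*` slice_values f.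
Proof.
move=> [p c]; rewrite /supp /slices_fun /= => nz.
have pc : (chi @` supp (f p : group_ring R G)) c.
  by apply: contrapT => /slice_eq0 s0; rewrite s0 eqxx in nz.
have fp : f p != 0 by case: pc => g gp _; apply: contra_neq gp => ->.
by split=> //; exists p.
Qed.

Fact slices_finite f :
  slices_fun f \in @free_pred (group_ring R K) (P * RR)%type.
Proof.
apply/asboolP/(sub_finite_set (@slices_supp f))/finite_setX.
  exact: free_finite.
exact: slice_values_finite.
Qed.

Definition slices (f : res (free_module (group_ring R G) P)) :
  free_module (group_ring R K) (P * RR)%type := FreeElt (slices_finite f).

Fact slices_linear : linear slices.
Proof.
move=> a x y; apply/val_inj/funext => -[p c].
exact: (slice_linear c a (x p) (y p)).
Qed.

HB.instance Definition _ := GRing.isLinear.Build (group_ring R K)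
  (res (free_module (group_ring R G) P))
  (free_module (group_ring R K) (P * RR)%type) *:%R slices slices_linear.

Definition unslice : {linear free_module (group_ring R K) (P * RR)%type -> res P} :=
  free_ext (fun x => group_elt (transversal x.2) *: x.1 : res P).

Lemma unslice_slices f : unslice (slices f) = free_cover P f.
Proof.
have fE := slice_values_finite f; have ff := free_finite f.
rewrite /= /free_ext (@fsumT_widen _ _ _ (supp f `*` slice_values f)); last first.
  move=> x; rewrite /supp /= => nz; apply: slices_supp.
  by apply: contra_neq nz => /= ->; rewrite scale0r.
rewrite [RHS](@fsumT_widen _ _ _ (supp f)); last first.
  by move=> p; rewrite /supp /=; apply: contra_neq => ->; rewrite scale0r.
rewrite -(@pair_fsbig _ _ _ _ _ _ _ (fun p c =>
   (slice c (f p) : group_ring R K) *: (group_elt (transversal c) *: p : res P))) //.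
apply: eq_fsbigr => p /set_mem fp.
rewrite -[in RHS](@slice_sum (slice_values f) (f p)) //; last first.
  by move=> c ?; exists p.
rewrite !fsbig_finite // scaler_suml.
by apply: eq_bigr => c _; rewrite -scalerA.
Qed.

(** A section of the free cover followed by [slices] embeds [P] in a free module over the group ring
    of the kernel, and [unslice] retracts this embedding. *)
Lemma restrict_projective : projective P -> projective (res P).
Proof.
move=> /projective_free_section[s sP].
apply: (@projective_retract _ (res P) _ (slices \o restrict_map s) unslice).
  by move=> x /=; rewrite unslice_slices; apply: sP.
exact: free_projective.
Qed.

End RestrictedProjective.

(** * Truncation of Novikov cochains *)

Section Truncation.
Variables (RR : realType) (R : nzRingType) (G : groupType) (chi : character G RR).
Local Notation K := (char_ker chi).
Local Notation S := (group_ring R G).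
Local Notation res := (restrict_scalars (@ker_incl RR R G chi)).

Definition completion (Phi : supports G) (x : S^o) : fseries R Phi :=
  of_group_ring Phi x.

Fact completion_linear (Phi : supports G) : linear (completion Phi).
Proof.
by move=> a x y; rewrite /completion rmorphD; congr (_ + _); apply: rmorphM.
Qed.

HB.instance Definition _ (Phi : supports G) := GRing.isLinear.Build S S^o
  (fseries R Phi) *:%R (completion Phi) (@completion_linear Phi).

Section TruncationMap.
Variables (Phi : supports G) (D : pred RR).
Hypothesis finD : forall A, Phi A -> finite_set [set g | A g /\ D (chi g)].

Fact trunc_small (x : fseries R Phi) :
  (fun g => if D (chi g) then x g else 0) \in fseries_pred (finite_supports G).
Proof.
apply/asboolP/(sub_finite_set _ (finD (fseries_small x))) => g.
by rewrite /supp /=; case: ifP => // _; rewrite eqxx.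
Qed.

Definition trunc (x : res (fseries R Phi)) : res S^o := FSeries (trunc_small x).

(** Truncation depends on [g] only through [chi g], which translation by the kernel leaves
    unchanged. *)
Fact trunc_linear : linear trunc.
Proof.
move=> a x y; apply/val_inj/funext => g.
rewrite -[RHS]/(conv (ext0 a) (trunc x : S) g + (trunc y : S) g).
rewrite -[LHS]/(if D (chi g) then conv (ext0 a) (x : fseries R Phi) g
  + (y : fseries R Phi) g else 0) /= !conv_ext0.
have chiV (k : K) : chi ((ker_val k)^-1 * g)%g = chi g.
  by rewrite charM charV (eqP (ker_valP k)) oppr0 add0r.
case: ifP => Dg; last by rewrite addr0 fsumT0 // => k; rewrite chiV Dg mulr0.
by congr (_ + _); apply: eq_fsbigr => k _; rewrite chiV Dg.
Qed.

HB.instance Definition _ := GRing.isLinear.Build (group_ring R K)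
  (res (fseries R Phi)) (res S^o) *:%R trunc trunc_linear.

End TruncationMap.

Variables (Q : resolution (trivial_module R G)) (n : nat).
Local Notation QK := (restrict_trivial_resolution chi Q).

Lemma coboundary_restrict (M : lmodType S) (c : Q n -> M) :
  is_coboundary c -> @is_coboundary _ _ QK (res M) n c.
Proof. by case: n c => [|m] c //= [b bP]; exists (restrict_map b). Qed.

Lemma coboundary_of_novikov (c : {linear Q n -> S^o}) :
  (forall y, c (res_d Q n y) = 0) ->
  cohomology_vanishes Q n (novikov_ring R chi : lmodType S) ->
  cohomology_vanishes Q n (novikov_ring R (opp_char chi) : lmodType S) ->
  @is_coboundary _ _ QK (res S^o) n c.
Proof.
move=> cd H H'.
(* One inequality is strict and the other weak, so that each [g] is kept by exactly one truncation
   and the two add up to [c]. *)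
pose neg r := (r : RR) < 0; pose nneg r := 0 <= (r : RR).
have fin_neg A : novikov_supports chi A -> finite_set [set g | A g /\ neg (chi g)].
  by move=> /(_ 0); apply: sub_finite_set => g [Ag /ltW].
have fin_nneg A : novikov_supports (opp_char chi) A ->
    finite_set [set g | A g /\ nneg (chi g)].
  by move=> /(_ 0); apply: sub_finite_set => g [Ag g0]; split=> //=; rewrite oppr_le0.
have vanish (Phi : supports G) (D : pred RR)
    (finD : forall A, Phi A -> finite_set [set g | A g /\ D (chi g)]) :
    cohomology_vanishes Q n (fseries R Phi : lmodType S) ->
    @is_coboundary _ _ QK (res S^o) n (fun x => trunc finD (completion Phi (c x))).
  move=> Phi0; apply: (coboundary_comp (trunc finD)).
  apply: (@coboundary_restrict _ (completion Phi \o c)).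
  apply: (Phi0 (completion Phi \o c)) => y /=.
  by rewrite cd linear0.
apply: eq_coboundary (coboundaryD (vanish _ _ fin_neg H) (vanish _ _ fin_nneg H')) => x.
apply/val_inj/funext => g.
transitivity ((if chi g < 0 then (c x : S) g else 0) +
  (if 0 <= chi g then (c x : S) g else 0)); first reflexivity.
by rewrite leNgt; case: (chi g < 0); rewrite ?addr0 ?add0r.
Qed.

(** In positive degree, a primitive of the identity is a retraction of the incoming differential's
    source, [Q n.-1], onto [Q n]. *)
Lemma coboundary_id_kernel (P : resolution (trivial_module R G)) :
  projective_resolution P -> finitely_generated (P n) ->
  projective_resolution Q -> (forall y : Q n.+1, y = 0) ->
  cohomology_vanishes Q n (novikov_ring R chi : lmodType S) ->
  cohomology_vanishes Q n (novikov_ring R (opp_char chi) : lmodType S) ->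
  @is_coboundary _ _ QK (QK n) n id.
Proof.
move=> projP fgP projQ Q0 H H'.
have [f [g [_ _ fgB]]] := coboundary_equiv n projP projQ.
(* The differential into [Q n] is zero, so every linear map out of [Q n] is a cocycle. *)
have d0 y : res_d Q n y = 0 by rewrite (Q0 y) linear0.
have [k [e [l lP]]] := fg_projective_coordinates (projP n) fgP.
(* A cocycle with values in [S], followed by the linear map [a |-> a *: f (e i)]; summing over [i]
   gives [f (g x)]. *)
have lB i : @is_coboundary _ _ QK (QK n) n (fun x => (l i (g x) : S) *: f (e i)).
  have u_linear : linear (fun a : S^o => (a : S) *: f (e i)).
    by move=> a x y; rewrite scalerDl scalerA.
  pose u := HB.pack_for {linear S^o -> Q n} (fun a : S^o => (a : S) *: f (e i))
    (GRing.isLinear.Build _ _ _ _ _ u_linear).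
  have ld y : (l i \o g) (res_d Q n y) = 0 by rewrite d0 linear0.
  pose uK : {linear res S^o -> res (Q n)} := restrict_map u.
  exact: (coboundary_comp uK (coboundary_of_novikov ld H H')).
have idB : is_coboundary (fun x => x - f (g x)) := fgB _ idfun d0.
apply: eq_coboundary (coboundaryD (coboundary_restrict idB)
  (coboundary_sum (index_enum 'I_k) lB)) => x.
rewrite [X in _ - f X](lP (g x)) linear_sum.
under [X in _ - X]eq_bigr do rewrite linearZ.
exact: subrK.
Qed.

End Truncation.

Lemma cd_leW (R : nzRingType) (G : groupType) (m : nat) :
  cd_le R G m -> (cd R G <= (m%:Z)%:E)%E.
Proof.
move=> Gm; rewrite /cd; case: pselect => [ex_n|nex].
  by case: ex_minnP => k _ kmin; rewrite lee_fin lez_nat; apply/kmin/asboolP.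
by case: nex; exists m; apply/asboolP.
Qed.

Theorem theoremD (RR : realType) (R : nzRingType) (G : groupType) (n : nat)
    (chi : character G RR) :
  type_FP R G ->
  cd R G = (n%:Z)%:E ->
  nontrivial chi ->
  (forall x : group_cohomology n
     (novikov_ring R chi : lmodType (group_ring R G)), x = 0) ->
  (forall x : group_cohomology n
     (novikov_ring R (opp_char chi) : lmodType (group_ring R G)), x = 0) ->
  (cd R (char_ker chi) < (n%:Z)%:E)%E.
Proof.
move=> [P [_ [projP fgP _]]] /cdP[[Q [projQ lenQ]] _] _ H H'.
(* [Ext] is computed from the free resolution; its vanishing is moved to the resolution [Q] of
   length [n]. *)
have vanish (M : lmodType (group_ring R G)) :
    (forall x : group_cohomology n M, x = 0) -> cohomology_vanishes Q n M.
  move=> /cohomology_eq0; apply: cohomology_vanishes_indep projQ.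
  exact: free_resolution_projective.
have projQK : projective_resolution (restrict_trivial_resolution chi Q).
  by move=> k; apply: restrict_projective (projQ k).
have := coboundary_id_kernel projP (fgP n) projQ (lenQ n.+1 (ltnSn n))
  (vanish _ H) (vanish _ H').
(* For [n = 0] coboundaries are zero, so [Q 0 = 0], although [Q 0] maps onto the nonzero ring [R];
   for [n = m.+1] the primitive [r] is the retraction sought. *)
case: n {H H' vanish} lenQ => [|m] lenQ /= => [Q0|[r rP]].
  have [y y1] := @res_surj _ _ Q (1 : R).
  by move: y1; rewrite [y]Q0 linear0 => /esym/eqP; rewrite oner_eq0.
have cd_m : cd_le R (char_ker chi) m.
  by apply: shorten_resolution projQK _ => // x; apply/esym/rP.
by apply: le_lt_trans (cd_leW cd_m) _; rewrite lte_fin ltz_nat.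
Qed.
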